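(* Let $(Q,\&,k)$ be a unital quantale with at least two elements. Then the functor $\mathscr{P}\colon \mathsf{Set}(Q)^{\mathrm{op}}\to \mathsf{Set}(Q)$ is monadic.
   Context: A unital quantale $(Q,\&,k)$ is a monoid with unit $k$ whose underlying set $Q$ is a complete lattice (top $1$, bottom $0$) such that $\&$ distributes over arbitrary suprema in each variable. For $r,q\in Q$ put $r/q=\bigvee\{p\in Q\mid p\,\&\,q\le r\}$. For a set $X$ and $\lambda,\gamma\in Q^X$ put $\lambda\swarrow\gamma=\bigwedge_{x\in X}\lambda(x)/\gamma(x)\in Q$. The Goguen category $\mathsf{Set}(Q)$ has as objects the pairs $(X,\alpha)$ with $X$ a set and $\alpha\colon X\to Q$ a map; a morphism (Goguen map) $f\colon(X,\alpha)\to(Y,\beta)$ is a map $f\colon X\to Y$ with $\alpha(x)\le\beta(f(x))$ for all $x\in X$; composition is that of maps. The functor $\mathscr{P}\colon\mathsf{Set}(Q)^{\mathrm{op}}\to\mathsf{Set}(Q)$ is given on objects by $\mathscr{P}(X,\alpha)=(Q^X,\alpha^\uparrow)$, where $\alpha^\uparrow(\gamma)=\gamma\swarrow\alpha$ for $\gamma\in Q^X$, and sends a Goguen map $f\colon(X,\alpha)\to(Y,\beta)$ to the Goguen map $\mathscr{P}f\colon(Q^Y,\beta^\uparrow)\to(Q^X,\alpha^\uparrow)$, $\lambda\mapsto\lambda\circ f$. A functor $G\colon\mathcal{B}\to\mathcal{A}$ is monadic if it has a left adjoint $F$ such that the comparison functor from $\mathcal{B}$ to the Eilenberg-Moore category of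 the monad $(GF,G\varepsilon F,\eta)$ on $\mathcal{A}$, given by $B\mapsto(GB,G\varepsilon_B)$ and $f\mapsto Gf$, is an equivalence of categories (here $\eta$ and $\varepsilon$ are the unit and counit of $F\dashv G$). *)

(* Defs.v *)
From HB Require Import structures.
From mathcomp Require Import all_boot all_order.
From mathcomp Require Import boolp classical_sets.

Set Implicit Arguments.
Unset Strict Implicit.
Unset Printing Implicit Defensive.

Import Order.TTheory.

Local Open Scope classical_set_scope.

Record category := Category {
  obj :> Type;
  hom : obj -> obj -> Type;
  idm : forall A, hom A A;
  comp : forall A B C, hom B C -> hom A B -> hom A C;
  comp1m : forall A B (f : hom A B), comp (idm B) f = f;
  compm1 : forall A B (f : hom A B), comp f (idm A) = f;
  compA : forall A B C D (h : hom C D) (g : hom B C) (f : hom A B),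
    comp h (comp g f) = comp (comp h g) f }.

Arguments hom {c} A B.
Arguments idm {c} A.
Arguments comp {c A B C} g f.

Declare Scope cat_scope.
Delimit Scope cat_scope with cat.
Local Open Scope cat_scope.
Notation "g \c f" := (comp g f)
  (at level 40, left associativity) : cat_scope.

Definition opposite (C : category) : category :=
  @Category (obj C) (fun A B => @hom C B A) (@idm C)
    (fun A B D g f => f \c g)
    (fun A B f => compm1 f)
    (fun A B f => comp1m f)
    (fun A B D E h g f => esym (compA f g h)).

Record functor (C D : category) := Functor {
  fobj :> C -> D;
  fmap : forall A B : C, hom A B -> hom (fobj A) (fobj B);
  fmap1 : forall A : C, fmap (idm A) = idm (fobj A);
  fmapM : forall (A B E : C) (g : hom B E) (f : hom A B),
    fmap (g \c f) = fmap g \c fmap f }.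

Arguments fmap {C D} F {A B} f : rename.

Definition fid (C : category) : functor C C :=
  @Functor C C (fun A => A) (fun A B f => f)
    (fun A => erefl) (fun A B E g f => erefl).

Section FunctorComposition.
Variables (C D E : category) (G : functor D E) (F : functor C D).

Let fcomp_map (A B : C) (f : hom A B) : hom (G (F A)) (G (F B)) :=
  fmap G (fmap F f).

Lemma fcomp_map1 (A : C) : fcomp_map (idm A) = idm (G (F A)).
Proof. by rewrite /fcomp_map !fmap1. Qed.

Lemma fcomp_mapM (A B X : C) (g : hom B X) (f : hom A B) :
  fcomp_map (g \c f) = fcomp_map g \c fcomp_map f.
Proof. by rewrite /fcomp_map !fmapM. Qed.

Definition fcomp : functor C E :=
  @Functor C E (fun A => G (F A)) fcomp_map fcomp_map1 fcomp_mapM.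
End FunctorComposition.

Record nat_trans (C D : category) (F G : functor C D) := NatTrans {
  nt_app :> forall A : C, hom (F A) (G A);
  nt_nat : forall (A B : C) (f : hom A B),
    nt_app B \c fmap F f = fmap G f \c nt_app A }.

Definition is_iso (C : category) (A B : C) (f : hom A B) : Prop :=
  exists g : hom B A, g \c f = idm A /\ f \c g = idm B.

Definition naturally_isomorphic (C D : category) (F G : functor C D) : Prop :=
  exists t : nat_trans F G, forall A : C, is_iso (t A).

Definition is_equivalence (C D : category) (K : functor C D) : Prop :=
  exists H : functor D C,
    naturally_isomorphic (fid C) (fcomp H K) /\
    naturally_isomorphic (fcomp K H) (fid D).

(** [adjunction F G] is the data of [F] being left adjoint to [G]. *)
Record adjunction (A B : category) (F : functor A B) (G : functor B A) :=
  Adjunction {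
  adj_unit : nat_trans (fid A) (fcomp G F);
  adj_counit : nat_trans (fcomp F G) (fid B);
  adj_triangleL : forall X : A,
    adj_counit (F X) \c fmap F (adj_unit X) = idm (F X);
  adj_triangleR : forall Y : B,
    fmap G (adj_counit Y) \c adj_unit (G Y) = idm (G Y) }.

Record monad (A : category) := Monad {
  mfun :> functor A A;
  meta : nat_trans (fid A) mfun;
  mmu : nat_trans (fcomp mfun mfun) mfun;
  mmu_etaL : forall X : A, mmu X \c meta (mfun X) = idm (mfun X);
  mmu_etaR : forall X : A, mmu X \c fmap mfun (meta X) = idm (mfun X);
  mmuA : forall X : A, mmu X \c mmu (mfun X) = mmu X \c fmap mfun (mmu X) }.

Section MonadOfAdjunction.
Variables (A B : category) (F : functor A B) (G : functor B A).
Variable adj : adjunction F G.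

Let eps := adj_counit adj.
Let T := fcomp G F.

Let mu_app (X : A) : hom (fcomp T T X) (T X) := fmap G (eps (F X)).

Lemma adj_mu_nat (X Y : A) (f : hom X Y) :
  mu_app Y \c fmap (fcomp T T) f = fmap T f \c mu_app X.
Proof. by rewrite /mu_app /= -!fmapM (nt_nat eps (fmap F f)). Qed.

Definition adj_mu : nat_trans (fcomp T T) T := NatTrans adj_mu_nat.

Lemma adj_mu_etaL (X : A) : adj_mu X \c adj_unit adj (T X) = idm (T X).
Proof. exact: (adj_triangleR adj (F X)). Qed.

Lemma adj_mu_etaR (X : A) : adj_mu X \c fmap T (adj_unit adj X) = idm (T X).
Proof. by rewrite /= /mu_app -fmapM adj_triangleL fmap1. Qed.

Lemma adj_muA (X : A) :
  adj_mu X \c adj_mu (T X) = adj_mu X \c fmap T (adj_mu X).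
Proof. by rewrite /= /mu_app -!fmapM -(nt_nat eps (eps (F X))). Qed.

Definition monad_of_adjunction : monad A :=
  @Monad A T (adj_unit adj) adj_mu adj_mu_etaL adj_mu_etaR adj_muA.
End MonadOfAdjunction.

Section EilenbergMoore.
Variables (A : category) (T : monad A).

Record algebra := Algebra {
  alg_obj : A;
  alg_str : hom (T alg_obj) alg_obj;
  alg_unit : alg_str \c meta T alg_obj = idm alg_obj;
  alg_assoc : alg_str \c mmu T alg_obj = alg_str \c fmap T alg_str }.

Record algebra_hom (X Y : algebra) := AlgebraHom {
  ah_map : hom (alg_obj X) (alg_obj Y);
  ah_comm : ah_map \c alg_str X = alg_str Y \c fmap T ah_map }.

Lemma algebra_hom_eq (X Y : algebra) (f g : algebra_hom X Y) :
  ah_map f = ah_map g -> f = g.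
Proof.
case: f g => [f pf] [g pg] /= fg; move: pf pg.
by rewrite fg => pf pg; rewrite (Prop_irrelevance pf pg).
Qed.

Lemma ah_id_comm (X : algebra) :
  idm (alg_obj X) \c alg_str X = alg_str X \c fmap T (idm (alg_obj X)).
Proof. by rewrite fmap1 comp1m compm1. Qed.

Lemma ah_comp_comm (X Y Z : algebra)
    (g : algebra_hom Y Z) (f : algebra_hom X Y) :
  (ah_map g \c ah_map f) \c alg_str X
    = alg_str Z \c fmap T (ah_map g \c ah_map f).
Proof. by rewrite fmapM -compA ah_comm !compA ah_comm. Qed.

Definition ah_id (X : algebra) : algebra_hom X X := AlgebraHom (ah_id_comm X).

Definition ah_comp (X Y Z : algebra)
    (g : algebra_hom Y Z) (f : algebra_hom X Y) : algebra_hom X Z :=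
  AlgebraHom (ah_comp_comm g f).

Lemma ah_comp1m (X Y : algebra) (f : algebra_hom X Y) :
  ah_comp (ah_id Y) f = f.
Proof. by apply: algebra_hom_eq; apply: comp1m. Qed.

Lemma ah_compm1 (X Y : algebra) (f : algebra_hom X Y) :
  ah_comp f (ah_id X) = f.
Proof. by apply: algebra_hom_eq; apply: compm1. Qed.

Lemma ah_compA (X Y Z W : algebra) (h : algebra_hom Z W)
    (g : algebra_hom Y Z) (f : algebra_hom X Y) :
  ah_comp h (ah_comp g f) = ah_comp (ah_comp h g) f.
Proof. by apply: algebra_hom_eq; apply: compA. Qed.

Definition eilenberg_moore : category :=
  @Category algebra algebra_hom ah_id ah_comp ah_comp1m ah_compm1 ah_compA.
End EilenbergMoore.

Section Comparison.
Variables (A B : category) (F : functor A B) (G : functor B A).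
Variable adj : adjunction F G.

Let eps := adj_counit adj.
Let T := monad_of_adjunction adj.

Lemma cmp_unit (Y : B) : fmap G (eps Y) \c meta T (G Y) = idm (G Y).
Proof. exact: (adj_triangleR adj Y). Qed.

Lemma cmp_assoc (Y : B) :
  fmap G (eps Y) \c mmu T (G Y) = fmap G (eps Y) \c fmap T (fmap G (eps Y)).
Proof. by rewrite /= -!fmapM -(nt_nat eps (eps Y)). Qed.

Definition cmp_obj (Y : B) : eilenberg_moore T :=
  @Algebra A T (G Y) (fmap G (eps Y)) (cmp_unit Y) (cmp_assoc Y).

Lemma cmp_comm (Y Z : B) (f : hom Y Z) :
  fmap G f \c alg_str (cmp_obj Y) = alg_str (cmp_obj Z) \c fmap T (fmap G f).
Proof. by rewrite /= -!fmapM (nt_nat eps f). Qed.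

Definition cmp_map (Y Z : B) (f : hom Y Z) : hom (cmp_obj Y) (cmp_obj Z) :=
  @AlgebraHom A T (cmp_obj Y) (cmp_obj Z) (fmap G f) (cmp_comm f).

Lemma cmp_map1 (Y : B) : cmp_map (idm Y) = idm (cmp_obj Y).
Proof. by apply: algebra_hom_eq; apply: fmap1. Qed.

Lemma cmp_mapM (X Y Z : B) (g : hom Y Z) (f : hom X Y) :
  cmp_map (g \c f) = cmp_map g \c cmp_map f.
Proof. by apply: algebra_hom_eq; apply: fmapM. Qed.

Definition comparison : functor B (eilenberg_moore T) :=
  @Functor B (eilenberg_moore T) cmp_obj cmp_map cmp_map1 cmp_mapM.
End Comparison.

Definition monadic (B A : category) (G : functor B A) : Prop :=
  exists (F : functor A B) (adj : adjunction F G),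
    is_equivalence (comparison adj).

(** Orders and monoids carry a choice operator, as everywhere in MathComp; by
    [gen_eqMixin] and [gen_choiceMixin] any [Type] can be given one, so this
    restricts neither complete lattices nor quantales. In a quantale,
    [(p * q)%g] is the tensor p & q and [1%g] is the unit k. *)
HB.mixin Record POrder_isCompleteLattice d T of Order.POrder d T := {
  csup : set T -> T;
  cinf : set T -> T;
  csupP : forall S : set T, supremums S (csup S);
  cinfP : forall S : set T, infimums S (cinf S)
}.

#[short(type="completeLatticeType")]
HB.structure Definition CompleteLattice d :=
  {T of POrder_isCompleteLattice d T & Order.POrder d T}.

HB.mixin Record Monoid_isUnitalQuantale d T
    of CompleteLattice d T & Monoid T := {
  mulg_csupr : forall (p : T) (S : set T),
    (p * csup S)%g = csup [set (p * s)%g | s in S];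
  mulg_csupl : forall (S : set T) (p : T),
    (csup S * p)%g = csup [set (s * p)%g | s in S]
}.

#[short(type="unitalQuantaleType")]
HB.structure Definition UnitalQuantale d :=
  {T of Monoid_isUnitalQuantale d T & CompleteLattice d T & Monoid T}.

Section Residuals.
Variables (d : Order.disp_t) (Q : unitalQuantaleType d).

Definition qdiv (r q : Q) : Q := csup [set p : Q | (p * q)%g <= r]%O.

Definition swarrow (X : Type) (lam gam : X -> Q) : Q :=
  cinf (range (fun x => qdiv (lam x) (gam x))).

Lemma mulg_le2l (p q r : Q) : (q <= r)%O -> (p * q <= p * r)%O%g.
Proof.
move=> qr; have [ub lub] := csupP [set q; r].
have <- : csup [set q; r] = r.
  apply/le_anti/andP; split; last by apply: ub; right.
  by apply: lub => x [->//|->].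
rewrite mulg_csupr; have [ub' _] := csupP [set (p * s)%g | s in [set q; r]].
by apply: ub'; exists q => //; left.
Qed.

Lemma qdiv_le2l (r p q : Q) : (p <= q)%O -> (qdiv r q <= qdiv r p)%O.
Proof.
move=> pq; have [_ lub] := csupP [set s : Q | (s * q)%g <= r]%O.
apply: lub => s /= sqr; have [ub _] := csupP [set t : Q | (t * p)%g <= r]%O.
by apply: ub; apply: le_trans sqr; apply: mulg_le2l.
Qed.

End Residuals.

Section Goguen.
Variables (d : Order.disp_t) (Q : unitalQuantaleType d).

Record goguen_obj := GoguenObj { gset : Type; gdeg : gset -> Q }.

Record goguen_map (X Y : goguen_obj) := GoguenMap {
  gfun :> gset X -> gset Y;
  gfun_le : forall x : gset X, (gdeg x <= gdeg (gfun x))%O }.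

Lemma goguen_map_eq (X Y : goguen_obj) (f g : goguen_map X Y) :
  gfun f = gfun g -> f = g.
Proof.
case: f g => [f pf] [g pg] /= fg; move: pf pg.
by rewrite fg => pf pg; rewrite (Prop_irrelevance pf pg).
Qed.

Definition goguen_id (X : goguen_obj) : goguen_map X X :=
  @GoguenMap X X (fun x => x) (fun x => lexx (gdeg x)).

Definition goguen_comp (X Y Z : goguen_obj)
    (g : goguen_map Y Z) (f : goguen_map X Y) : goguen_map X Z :=
  @GoguenMap X Z (fun x => g (f x))
    (fun x => le_trans (gfun_le f x) (gfun_le g (f x))).

Lemma goguen_comp1m (X Y : goguen_obj) (f : goguen_map X Y) :
  goguen_comp (goguen_id Y) f = f.
Proof. exact: goguen_map_eq. Qed.

Lemma goguen_compm1 (X Y : goguen_obj) (f : goguen_map X Y) :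
  goguen_comp f (goguen_id X) = f.
Proof. exact: goguen_map_eq. Qed.

Lemma goguen_compA (X Y Z W : goguen_obj) (h : goguen_map Z W)
    (g : goguen_map Y Z) (f : goguen_map X Y) :
  goguen_comp h (goguen_comp g f) = goguen_comp (goguen_comp h g) f.
Proof. exact: goguen_map_eq. Qed.

Definition goguen : category :=
  @Category goguen_obj goguen_map goguen_id goguen_comp
    goguen_comp1m goguen_compm1 goguen_compA.

Definition powerset_obj (X : goguen) : goguen :=
  @GoguenObj (gset X -> Q) (fun gam => swarrow gam (@gdeg X)).

Lemma powerset_map_le (X Y : goguen) (f : goguen_map X Y) (lam : gset Y -> Q) :
  (@gdeg (powerset_obj Y) lam <= @gdeg (powerset_obj X) (lam \o f))%O.
Proof.
rewrite /= /swarrow.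
have [_ glb] := cinfP (range (fun x => qdiv ((lam \o f) x) (gdeg x))).
apply: glb => _ [x _ <-].
have [lb _] := cinfP (range (fun y => qdiv (lam y) (gdeg y))).
apply: le_trans (qdiv_le2l (lam (f x)) (gfun_le f x)).
by apply: lb; exists (f x).
Qed.

Definition powerset_map (X Y : goguen) (f : goguen_map X Y) :
    goguen_map (powerset_obj Y) (powerset_obj X) :=
  @GoguenMap (powerset_obj Y) (powerset_obj X)
    (fun lam => lam \o f) (powerset_map_le f).

Lemma powerset_map1 (X : goguen) :
  powerset_map (goguen_id X) = goguen_id (powerset_obj X).
Proof. exact: goguen_map_eq. Qed.

Lemma powerset_mapM (X Y Z : goguen) (g : goguen_map Y X)
    (f : goguen_map Z Y) :
  powerset_map (goguen_comp g f)
    = goguen_comp (powerset_map f) (powerset_map g).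
Proof. exact: goguen_map_eq. Qed.

(** In [opposite goguen] a morphism Y -> X is a Goguen map X -> Y. *)
Definition goguen_powerset : functor (opposite goguen) goguen :=
  @Functor (opposite goguen) goguen powerset_obj
    (fun Y X (f : @hom goguen X Y) => powerset_map f)
    powerset_map1
    (fun X Y Z g f => powerset_mapM f g).

End Goguen.

(* Main.v *)
From mathcomp Require Import all_boot all_order.
From mathcomp Require Import boolp classical_sets.
Require Import Defs.

Set Implicit Arguments.
Unset Strict Implicit.
Unset Printing Implicit Defensive.

Import Order.TTheory.

Local Open Scope classical_set_scope.
Local Open Scope cat_scope.

(** The proof runs through the crude monadicity theorem: a right adjoint
    [G : B -> A] is monadic as soon as it reflects isomorphisms and every
    reflexive pair of B has a coequalizer that G preserves
    ([crude_monadicity]).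

    The left adjoint exists because a Goguen map Y -> P X and a Goguen map
    X -> P' Y are both the same thing as a matrix f : Y * X -> Q with
    b(y) & a(x) <= f(y, x); here P' is the analogue of P built from the other
    residual of the possibly noncommutative tensor. The unit and the counit
    are evaluation maps ([powerset_adjunction]).

    P reflects isomorphisms ([powerset_reflects_isos]): if composition with f
    is bijective on Q-valued functions, then f is bijective, since Q has two
    elements to tell points apart. The inverse h of P f preserves degrees;
    applied to the degree function a of X, whose degree in P X is at least k,
    this gives b(f x) <= a(x), which says that the inverse of f is a Goguen
    map.

    A reflexive pair in the opposite of Set(Q) is a pair f, g : X -> Y with a
    common retraction; its coequalizer there is the equalizer e : E -> X in
    Set(Q), and P turns it into a coequalizer which is even split
    ([powerset_reflexive_coequalizers]). As for the ordinary power set functor,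
    the splittings are the right adjoints of composition with e and with f,
    namely universal quantification along e and f ([forall_along]). They are
    Goguen maps because e and f preserve degrees exactly, and the remaining
    identity is the Beck-Chevalley condition for the square
    f e = g e, which is a pullback thanks to the common retraction. *)

(** * Coequalizers *)

Section Coequalizers.
Variable C : category.

Definition coequalizes (X Y Z : C) (f g : hom X Y) (q : hom Y Z) : Prop :=
  q \c f = q \c g.

Definition is_coequalizer (X Y Z : C) (f g : hom X Y) (q : hom Y Z) : Prop :=
  coequalizes f g q /\
  forall (W : C) (h : hom Y W), coequalizes f g h ->
    exists! k : hom Z W, k \c q = h.

Definition reflexive_pair (X Y : C) (f g : hom X Y) : Prop :=
  exists s : hom Y X, f \c s = idm Y /\ g \c s = idm Y.

Lemma coequalizer_epi (X Y Z : C) (f g : hom X Y) (q : hom Y Z) :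
  is_coequalizer f g q ->
  forall (W : C) (u v : hom Z W), u \c q = v \c q -> u = v.
Proof.
move=> [qfg univ] W u v uv.
have [|k [_ ku]] := univ W (u \c q).
  by rewrite /coequalizes -!compA qfg.
by rewrite -(ku u erefl) -(ku v (esym uv)).
Qed.

Lemma split_epi (X Y : C) (f : hom X Y) (s : hom Y X) :
  f \c s = idm Y ->
  forall (W : C) (u v : hom Y W), u \c f = v \c f -> u = v.
Proof.
by move=> fs W u v uv; rewrite -[u]compm1 -[v]compm1 -fs !compA uv.
Qed.

(** The factorization of h through q is h s; it is forced by q s = 1, and t
    transports h f = h g to (h s) q = h. No universal property is involved, so
    such coequalizers are preserved by every functor. *)
Lemma split_coequalizer (X Y Z : C) (f g : hom X Y) (q : hom Y Z)
    (s : hom Z Y) (t : hom Y X) :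
  coequalizes f g q -> q \c s = idm Z -> f \c t = idm Y -> g \c t = s \c q ->
  is_coequalizer f g q.
Proof.
move=> qfg qs ft gt; split=> // W h hfg; exists (h \c s); split.
  by rewrite -compA -gt compA -hfg -compA ft compm1.
by move=> k <-; rewrite -compA qs compm1.
Qed.

Lemma coequalizer_unique (X Y Z W : C) (f g : hom X Y)
    (q : hom Y Z) (r : hom Y W) :
  is_coequalizer f g q -> is_coequalizer f g r ->
  exists2 i : hom Z W, is_iso i & i \c q = r.
Proof.
move=> cq cr; have [i [iq _]] := cq.2 _ _ cr.1; exists i => //.
have [j [jr _]] := cr.2 _ _ cq.1; exists j; split.
  by apply: (coequalizer_epi cq); rewrite -compA iq jr comp1m.
by apply: (coequalizer_epi cr); rewrite -compA jr iq comp1m.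
Qed.

Lemma coequalizer_iso (X Y Z W : C) (f g : hom X Y)
    (q : hom Y Z) (i : hom Z W) :
  is_coequalizer f g q -> is_iso i -> is_coequalizer f g (i \c q).
Proof.
move=> [qfg univ] [j [ji ij]]; split.
  by rewrite /coequalizes -!compA qfg.
move=> V h hfg; have [k [kq kuniq]] := univ V h hfg; exists (k \c j); split.
  by rewrite -compA (compA j) ji comp1m.
move=> l lq; rewrite (kuniq (l \c i)); last by rewrite -compA.
by rewrite -compA ij compm1.
Qed.

End Coequalizers.

(** * Equivalences of categories *)

Section Equivalences.
Variables (C D : category) (K : functor C D).
Hypothesis faithfulK : forall (X Y : C) (f g : hom X Y),
  fmap K f = fmap K g -> f = g.
Hypothesis fullK : forall (X Y : C) (h : hom (K X) (K Y)),
  exists f : hom X Y, fmap K f = h.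
Hypothesis surjK : forall Z : D, exists (X : C) (i : hom (K X) Z), is_iso i.

(** The quasi-inverse picks, for each object of D, an isomorphic object in
    the image of K; classical choice makes these picks into a function, and
    full faithfulness transports morphisms back. *)
Lemma fully_faithful_essentially_surjective_equivalence : is_equivalence K.
Proof.
pose lft X Y (h : hom (K X) (K Y)) : hom X Y := sval (cid (fullK h)).
have lftK X Y (h : hom (K X) (K Y)) : fmap K (lft X Y h) = h.
  exact: svalP (cid (fullK h)).
pose o (Z : D) : C := sval (cid (surjK Z)).
have oP (Z : D) : exists i : hom (K (o Z)) Z, is_iso i.
  exact: svalP (cid (surjK Z)).
pose t (Z : D) : hom (K (o Z)) Z := sval (cid (oP Z)).
have tP (Z : D) : is_iso (t Z) by exact: svalP (cid (oP Z)).
pose u (Z : D) : hom Z (K (o Z)) := sval (cid (tP Z)).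
have ut (Z : D) : u Z \c t Z = idm (K (o Z)) by case: (svalP (cid (tP Z))).
have tu (Z : D) : t Z \c u Z = idm Z by case: (svalP (cid (tP Z))).
pose Hmap (Z W : D) (f : hom Z W) : hom (o Z) (o W) :=
  lft _ _ (u W \c f \c t Z).
have Hmap1 Z : Hmap Z Z (idm Z) = idm (o Z).
  by apply: faithfulK; rewrite lftK fmap1 compm1 ut.
have HmapM (Z W V : D) (g : hom W V) (f : hom Z W) :
    Hmap _ _ (g \c f) = Hmap _ _ g \c Hmap _ _ f.
  apply: faithfulK; rewrite fmapM !lftK -!compA; congr comp; congr comp.
  by rewrite !compA tu comp1m.
pose H := Functor Hmap1 HmapM.
exists H; split.
- pose a (X : C) : hom X (H (K X)) := lft _ _ (u (K X)).
  have a_nat (X Y : C) (f : hom X Y) :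
      a Y \c fmap (fid C) f = fmap (fcomp H K) f \c a X.
    apply: faithfulK; rewrite !fmapM !lftK -!compA; congr comp.
    by rewrite tu compm1.
  exists (@NatTrans _ _ (fid C) (fcomp H K) a a_nat) => X.
  exists (lft (o (K X)) X (t (K X))); split;
    apply: faithfulK; rewrite fmapM !lftK fmap1; [exact: tu|exact: ut].
- have t_nat (Z W : D) (f : hom Z W) :
      t W \c fmap (fcomp K H) f = fmap (fid D) f \c t Z.
    by rewrite /= lftK !compA tu comp1m.
  by exists (@NatTrans _ _ (fcomp K H) (fid D) t t_nat).
Qed.

End Equivalences.

(** * The crude monadicity theorem *)

Definition reflects_isos (C D : category) (G : functor C D) : Prop :=
  forall (X Y : C) (f : hom X Y), is_iso (fmap G f) -> is_iso f.

Definition has_preserved_reflexive_coequalizers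
    (C D : category) (G : functor C D) : Prop :=
  forall (X Y : C) (f g : hom X Y), reflexive_pair f g ->
    exists (Z : C) (q : hom Y Z), is_coequalizer f g q /\
      is_coequalizer (fmap G f) (fmap G g) (fmap G q).

(** Every algebra is canonically presented by free ones: its structure map is
    split by the unit of the monad, so it is a coequalizer already in the base
    category. *)
Lemma algebra_coequalizer (A : category) (T : monad A)
    (X : eilenberg_moore T) :
  is_coequalizer (mmu T (alg_obj X)) (fmap T (alg_str X)) (alg_str X).
Proof.
apply: (@split_coequalizer _ _ _ _ _ _ _ (meta T (alg_obj X))
                           (meta T (T (alg_obj X)))).
- exact: alg_assoc.
- exact: alg_unit.
- exact: mmu_etaL.
- by rewrite -(nt_nat (meta T) (alg_str X)).
Qed.

(** Commuting with the structure maps is inherited by the inverse, because the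
    functor T sends inverses to inverses. *)
Lemma algebra_iso (A : category) (T : monad A) (X Y : eilenberg_moore T)
    (f : hom X Y) : is_iso (ah_map f) -> is_iso f.
Proof.
move=> [g [gf fg]].
have gP : g \c alg_str Y = alg_str X \c fmap T g.
  rewrite -[LHS]compm1 -(fmap1 T) -fg fmapM compA -(compA g) -ah_comm.
  by rewrite (compA g) gf comp1m.
by exists (AlgebraHom gP); split; apply: algebra_hom_eq.
Qed.

Section CrudeMonadicity.
Variables (A B : category) (F : functor A B) (G : functor B A).
Variable adj : adjunction F G.
Hypothesis Giso : reflects_isos G.
Hypothesis Gcoeq : has_preserved_reflexive_coequalizers G.

Let T := monad_of_adjunction adj.
Let eps := adj_counit adj.
Let eta := adj_unit adj.

Let counit_natural (X Y : B) (f : hom X Y) :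
  eps Y \c fmap F (fmap G f) = f \c eps X.
Proof. exact: (nt_nat eps f). Qed.

(** The free presentation of an algebra X is G applied to a reflexive pair in
    B, a common section being F of the unit. Its coequalizer q in B is
    preserved by G, so the target of G q is X up to an isomorphism i. This one
    construction gives both halves of the monadicity theorem: it inverts the
    comparison on objects and presents the objects of B. *)
Lemma algebra_resolution (X : eilenberg_moore T) :
  exists (Z : B) (q : hom (F (alg_obj X)) Z) (i : hom (alg_obj X) (G Z)),
    [/\ is_coequalizer (eps (F (alg_obj X))) (fmap F (alg_str X)) q,
        is_iso i & i \c alg_str X = fmap G q].
Proof.
have [|Z [q [qP GqP]]] :=
  Gcoeq (f := eps (F (alg_obj X))) (g := fmap F (alg_str X)).
  exists (fmap F (eta (alg_obj X))); split; first exact: (adj_triangleL adj).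
  by rewrite -(fmapM F) (alg_unit X) fmap1.
have [i i_iso ia] := coequalizer_unique (algebra_coequalizer X) GqP.
by exists Z, q, i.
Qed.

(** For X = G Y the resolution q and the counit at Y become coequalizers of
    the same pair after applying G. As G reflects isomorphisms, they agree up
    to isomorphism already in B. *)
Lemma counit_coequalizer (Y : B) :
  is_coequalizer (eps (F (G Y))) (fmap F (fmap G (eps Y))) (eps Y).
Proof.
have [Z [q [i [qP [j [ji ij]] iE]]]] :=
  algebra_resolution (cmp_obj adj Y).
have [|h [hq _]] := qP.2 Y (eps Y); first exact: esym (counit_natural (eps Y)).
suff h_iso : is_iso h by have := coequalizer_iso qP h_iso; rewrite hq.
apply: Giso.
suff -> : fmap G h = j by exists i.
have hi : fmap G h \c i = idm (G Y).
  apply: (coequalizer_epi (algebra_coequalizer (cmp_obj adj Y))).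
  by rewrite -compA iE comp1m -(fmapM G) hq.
by rewrite -[LHS]compm1 -ij compA hi comp1m.
Qed.

Lemma comparison_faithful (X Y : B) (f g : hom X Y) :
  fmap (comparison adj) f = fmap (comparison adj) g -> f = g.
Proof.
move=> /(congr1 (@ah_map _ _ _ _)) /= fg.
apply: (coequalizer_epi (counit_coequalizer X)).
by rewrite -!counit_natural fg.
Qed.

Lemma comparison_full (X Y : B)
    (h : hom (comparison adj X) (comparison adj Y)) :
  exists f : hom X Y, fmap (comparison adj) f = h.
Proof.
(* The transpose of h under the adjunction descends along the counit
   precisely because h commutes with the structure maps. *)
have hP := ah_comm h; rewrite /= in hP.
have [|f [fE _]] := (counit_coequalizer X).2 Y (eps Y \c fmap F (ah_map h)).
  rewrite /coequalizes -!compA -(fmapM F) hP (fmapM F).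
  rewrite -[X in _ \c X = _](counit_natural (fmap F (ah_map h))) !compA.
  by congr comp; exact/esym/(counit_natural (eps Y)).
exists f; apply: algebra_hom_eq.
apply: (coequalizer_epi (algebra_coequalizer (cmp_obj adj X))).
by rewrite /= -(fmapM G) fE (fmapM G) hP.
Qed.

Lemma comparison_essentially_surjective (X : eilenberg_moore T) :
  exists (Z : B) (i : hom (comparison adj Z) X), is_iso i.
Proof.
have [Z [q [i [qP [j [ji ij]] iE]]]] := algebra_resolution X.
have iP : i \c alg_str X = fmap G (eps Z) \c fmap T i.
  (* Both sides are compared after composition with the split epimorphism
     T a, where a is the structure map of X. *)
  apply: (split_epi (f := fmap T (alg_str X))
                    (s := fmap T (meta T (alg_obj X)))).
    by rewrite -(fmapM T) alg_unit (fmap1 T).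
  rewrite -[LHS]compA -alg_assoc -[RHS]compA -(fmapM T) compA iE /=.
  by rewrite -!(fmapM G) -[in LHS](counit_natural q).
pose iA : hom X (comparison adj Z) := @AlgebraHom _ T X (cmp_obj adj Z) i iP.
have [|k [k1 k2]] := @algebra_iso _ _ _ _ iA; first by exists j.
by exists Z, k, iA.
Qed.

Theorem crude_monadicity : is_equivalence (comparison adj).
Proof.
exact: (fully_faithful_essentially_surjective_equivalence
          comparison_faithful comparison_full
          comparison_essentially_surjective).
Qed.

End CrudeMonadicity.

(** * Residuals in a quantale *)

Section Residuation.
Variables (d : Order.disp_t) (Q : unitalQuantaleType d).

Lemma le_csup (S : set Q) (p : Q) : S p -> (p <= csup S)%O.
Proof. by move=> Sp; have [ub _] := csupP S; exact: ub. Qed.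

Lemma csup_le (S : set Q) (r : Q) :
  (forall p, S p -> (p <= r)%O) -> (csup S <= r)%O.
Proof. by move=> Sr; have [_ lub] := csupP S; exact: lub. Qed.

Lemma cinf_le (S : set Q) (p : Q) : S p -> (cinf S <= p)%O.
Proof. by move=> Sp; have [lb _] := cinfP S; exact: lb. Qed.

Lemma le_cinf (S : set Q) (r : Q) :
  (forall p, S p -> (r <= p)%O) -> (r <= cinf S)%O.
Proof. by move=> Sr; have [_ glb] := cinfP S; exact: glb. Qed.

Lemma mulg_le2r (p q r : Q) : (q <= r)%O -> (q * p <= r * p)%O%g.
Proof.
move=> qr; have <- : csup [set q; r] = r.
  apply/le_anti/andP; split; last by apply: le_csup; right.
  by apply: csup_le => x [->//|->].
by rewrite mulg_csupl; apply: le_csup; exists q => //; left.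
Qed.

Lemma qdiv_adjoint (p q r : Q) : (p <= qdiv r q)%O = (p * q <= r)%O%g.
Proof.
apply/idP/idP => [pr|]; last by move=> pq; apply: le_csup.
apply: le_trans (mulg_le2r q pr) _; rewrite mulg_csupl.
by apply: csup_le => _ [s sq <-].
Qed.

Lemma le_swarrow (X : Type) (p : Q) (lam gam : X -> Q) :
  (p <= swarrow lam gam)%O <-> forall x, (p * gam x <= lam x)%O%g.
Proof.
split=> [ple x|ple].
  by rewrite -qdiv_adjoint; apply: le_trans ple _; apply: cinf_le; exists x.
by apply: le_cinf => _ [x _ <-]; rewrite qdiv_adjoint.
Qed.

(** The mirror image of [swarrow], using the residual in the second argument
    of the tensor; the two differ when the tensor is not commutative. *)
Definition searrow (X : Type) (gam lam : X -> Q) : Q :=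
  csup [set p : Q | forall x, (gam x * p <= lam x)%O%g].

Lemma le_searrow (X : Type) (p : Q) (gam lam : X -> Q) :
  (p <= searrow gam lam)%O <-> forall x, (gam x * p <= lam x)%O%g.
Proof.
split=> [ple x|ple]; last exact: le_csup.
apply: le_trans (mulg_le2l (gam x) ple) _; rewrite mulg_csupr.
by apply: csup_le => _ [s sle <-].
Qed.

End Residuation.

(** * The left adjoint of the powerset functor *)

Section PowersetAdjunction.
Variables (d : Order.disp_t) (Q : unitalQuantaleType d).

Local Notation goguen := (goguen Q).
Local Notation P := (goguen_powerset Q).

Definition copowerset_obj (Y : goguen) : goguen :=
  @GoguenObj d Q (gset Y -> Q) (searrow (@gdeg d Q Y)).

Lemma copowerset_map_le (X Y : goguen) (f : hom X Y) (lam : gset Y -> Q) :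
  (@gdeg _ _ (copowerset_obj Y) lam <=
   @gdeg _ _ (copowerset_obj X) (lam \o f))%O.
Proof.
apply/le_searrow => x; apply: le_trans (mulg_le2r _ (gfun_le f x)) _.
exact: (le_searrow _ _ _).1 (lexx _) (f x).
Qed.

Definition copowerset_map (X Y : goguen) (f : hom X Y) :
    @hom (opposite goguen) (copowerset_obj X) (copowerset_obj Y) :=
  @GoguenMap d Q (copowerset_obj Y) (copowerset_obj X) (fun lam => lam \o f)
    (copowerset_map_le f).

Lemma copowerset_map1 (X : goguen) :
  copowerset_map (idm X) = idm (copowerset_obj X : opposite goguen).
Proof. exact: goguen_map_eq. Qed.

Lemma copowerset_mapM (X Y Z : goguen) (g : hom Y Z) (f : hom X Y) :
  copowerset_map (g \c f) = copowerset_map g \c copowerset_map f.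
Proof. exact: goguen_map_eq. Qed.

Definition goguen_copowerset : functor goguen (opposite goguen) :=
  @Functor goguen (opposite goguen) copowerset_obj copowerset_map
    copowerset_map1 copowerset_mapM.

Local Notation F := goguen_copowerset.

(** Both evaluation maps are Goguen maps by residuation: evaluation at x has
    degree at least that of x because b(x) & (b \ g) <= g(x) and
    (g / b) & b(x) <= g(x) for all g. *)
Lemma eval_unit_le (X : goguen) (x : gset X) :
  (gdeg x <= @gdeg _ _ (P (F X)) (fun gam => gam x))%O.
Proof.
apply/le_swarrow => gam; exact: (le_searrow _ _ _).1 (lexx _) x.
Qed.

Definition eval_unit (X : goguen) : hom X (P (F X)) :=
  @GoguenMap d Q X (P (F X)) (fun x gam => gam x) (@eval_unit_le X).

Lemma eval_counit_le (X : goguen) (x : gset X) :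
  (gdeg x <= @gdeg _ _ (F (P X) : goguen) (fun gam => gam x))%O.
Proof.
apply/le_searrow => gam; exact: (le_swarrow _ _ _).1 (lexx _) x.
Qed.

Definition eval_counit (X : opposite goguen) : hom (F (P X)) X :=
  @GoguenMap d Q X (F (P X)) (fun x gam => gam x) (@eval_counit_le X).

Lemma eval_unit_nat (X Y : goguen) (f : hom X Y) :
  eval_unit Y \c fmap (fid goguen) f = fmap (fcomp P F) f \c eval_unit X.
Proof. exact: goguen_map_eq. Qed.

Lemma eval_counit_nat (X Y : opposite goguen) (f : hom X Y) :
  eval_counit Y \c fmap (fcomp F P) f
  = fmap (fid (opposite goguen)) f \c eval_counit X.
Proof. exact: goguen_map_eq. Qed.

Lemma eval_triangleL (X : goguen) :
  eval_counit (F X) \c fmap F (eval_unit X) = idm (F X).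
Proof. exact: goguen_map_eq. Qed.

Lemma eval_triangleR (X : opposite goguen) :
  fmap P (eval_counit X) \c eval_unit (P X) = idm (P X).
Proof. exact: goguen_map_eq. Qed.

Definition powerset_adjunction : adjunction F P :=
  @Adjunction _ _ F P
    (@NatTrans _ _ (fid goguen) (fcomp P F) eval_unit eval_unit_nat)
    (@NatTrans _ _ (fcomp F P) (fid (opposite goguen)) eval_counit
       eval_counit_nat)
    eval_triangleL eval_triangleR.

End PowersetAdjunction.

(** * Universal quantification along a map *)

Section UniversalImage.
Variables (d : Order.disp_t) (Q : unitalQuantaleType d).

Local Notation goguen := (goguen Q).

(** The right adjoint of composition with i, i.e. the right Kan extension:
    quantification over the fibres of i, with value the top element where the
    fibre is empty. *)
Definition forall_along (X Y : Type) (i : X -> Y) (gam : X -> Q) : Y -> Q :=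
  fun y => cinf [set gam x | x in [set x | i x = y]].

Lemma forall_along_injective (X Y : Type) (i : X -> Y) (gam : X -> Q) (x : X) :
  injective i -> forall_along i gam (i x) = gam x.
Proof.
move=> i_inj; apply/le_anti/andP; split; first by apply: cinf_le; exists x.
by apply: le_cinf => _ [x' /= /i_inj -> <-].
Qed.

(** Outside the image of i the value is top, which does not lower the
    residual; on the image, i must not raise degrees. *)
Lemma forall_along_le (X Y : goguen) (i : gset X -> gset Y)
    (gam : gset X -> Q) :
  (forall x, gdeg (i x) <= gdeg x)%O ->
  (@gdeg _ _ (powerset_obj X) gam <=
   @gdeg _ _ (powerset_obj Y) (forall_along i gam))%O.
Proof.
move=> i_le; apply/le_swarrow => y; apply: le_cinf => _ [x /= <- <-].
apply: le_trans (mulg_le2l _ (i_le x)) _.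
exact: (le_swarrow _ _ _).1 (lexx _) x.
Qed.

Definition forall_map (X Y : goguen) (i : gset X -> gset Y)
    (i_le : forall x, (gdeg (i x) <= gdeg x)%O) :
    hom (powerset_obj X) (powerset_obj Y) :=
  @GoguenMap d Q (powerset_obj X) (powerset_obj Y) (forall_along i)
    (fun gam => forall_along_le gam i_le).

End UniversalImage.

(** * Exactness properties of the powerset functor *)

Section PowersetExactness.
Variables (d : Order.disp_t) (Q : unitalQuantaleType d).

Local Notation goguen := (goguen Q).
Local Notation P := (goguen_powerset Q).

Lemma goguen_map_apply (X Y : goguen) (f g : hom X Y) :
  f = g -> forall x, f x = g x.
Proof. by move=> ->. Qed.

Definition equalizer_obj (X Y : goguen) (f g : hom X Y) : goguen :=
  @GoguenObj d Q {x : gset X | f x = g x} (fun z => gdeg (sval z)).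

Definition equalizer_map (X Y : goguen) (f g : hom X Y) :
    hom (equalizer_obj f g) X :=
  @GoguenMap d Q (equalizer_obj f g) X sval (fun z => lexx _).

Lemma equalizer_map_injective (X Y : goguen) (f g : hom X Y) :
  injective (equalizer_map f g).
Proof. by move=> [x xP] [y yP] /= xy; exact: eq_exist. Qed.

Lemma equalizer_coequalizer (X Y : goguen) (f g : hom X Y) :
  @is_coequalizer (opposite goguen) Y X (equalizer_obj f g) f g
    (equalizer_map f g).
Proof.
split; first by apply: goguen_map_eq; apply/funext => -[].
move=> W h hfg.
have hE w : f (h w) = g (h w) by exact: goguen_map_apply hfg w.
exists (@GoguenMap d Q W (equalizer_obj f g) (fun w => exist _ (h w) (hE w))
          (gfun_le h)); split; first exact: goguen_map_eq.
move=> k kE; apply: goguen_map_eq; apply/funext => w.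
by apply: equalizer_map_injective; rewrite /= -kE.
Qed.

(** A common retraction r of f and g forces f to preserve degrees exactly and
    the fibres of f over g x to be empty or equal to {x} with x in the
    equalizer; the latter is the Beck-Chevalley condition. *)
Lemma powerset_reflexive_coequalizers : has_preserved_reflexive_coequalizers P.
Proof.
move=> Y X f g [r [rf rg]].
have rfE : cancel f r by exact: goguen_map_apply rf.
have rgE : cancel g r by exact: goguen_map_apply rg.
have f_le x : (gdeg (f x) <= gdeg x)%O by rewrite -{2}(rfE x); exact: gfun_le.
pose e := @equalizer_map X Y f g.
exists (@equalizer_obj X Y f g), e; split; first exact: equalizer_coequalizer.
have e_le z : (gdeg (e z) <= gdeg z)%O by exact: lexx.
apply: (split_coequalizer (s := forall_map e_le) (t := forall_map f_le)).
- apply: goguen_map_eq; apply/funext => lam; apply/funext => -[x fgx] /=.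
  by rewrite /comp /= fgx.
- apply: goguen_map_eq; apply/funext => mu; apply/funext => z.
  exact/forall_along_injective/equalizer_map_injective.
- apply: goguen_map_eq; apply/funext => gam; apply/funext => x.
  exact/forall_along_injective/(can_inj rfE).
- apply: goguen_map_eq; apply/funext => gam; apply/funext => x.
  (* Beck-Chevalley: f x' = g x forces x' = x. *)
  congr cinf; apply/seteqP; split => q [].
    move=> x' /= fgx <-; have xx' : x' = x by rewrite -(rfE x') fgx rgE.
    by rewrite xx' in fgx *; exists (exist _ x fgx).
  by case=> x' fgx' /= <- <-; exists x'.
Qed.

(** Injectivity of f uses that h is a section of composition with f,
    surjectivity that it is a retraction; both separate points by a function
    taking two values of Q. *)
Lemma powerset_reflects_isos (hQ : exists p q : Q, p <> q) : reflects_isos P.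
Proof.
case: hQ => a [b ab] Y X f [h [hf fh]].
have fK lam : h (lam \o f) = lam by exact: goguen_map_apply hf lam.
have hK gam x : h gam (f x) = gam x.
  by have /(congr1 (@^~ x)) := goguen_map_apply fh gam.
have f_inj : injective f.
  move=> x1 x2 fx12; apply: contrapT => x12.
  pose gam x := if `[< x = x1 >] then a else b.
  have : gam x1 = gam x2 by rewrite -!hK fx12.
  by rewrite /gam asboolT // asboolF // => /esym.
have f_surj y : exists x, f x = y.
  apply: contrapT => ny.
  pose lam y' := if `[< y' = y >] then a else b.
  have lamE : lam \o f = (fun=> b) \o f.
    apply/funext => x /=; rewrite /lam asboolF // => fx.
    by apply: ny; exists x.
  have /(congr1 (@^~ y)) : lam = fun=> b by rewrite -(fK lam) lamE fK.
  by rewrite /lam asboolT.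
have f_le x : (gdeg (f x) <= gdeg x)%O.
  (* The degree function of X has degree at least 1 in P X, hence so has its
     image under h, which extends it along f. *)
  rewrite -[leLHS]mul1g -(hK (@gdeg _ _ X) x).
  apply: (le_swarrow _ _ _).1 (f x).
  apply: le_trans (gfun_le h (@gdeg _ _ X)).
  by apply/le_swarrow => x'; rewrite mul1g.
pose g y := sval (cid (f_surj y)).
have fg y : f (g y) = y by exact: svalP (cid (f_surj y)).
have g_le y : (gdeg y <= gdeg (g y))%O by rewrite -{1}(fg y).
exists (@GoguenMap d Q Y X g g_le); split; apply: goguen_map_eq.
  by apply/funext => y; exact: fg.
by apply/funext => x; apply: f_inj; exact: fg.
Qed.

End PowersetExactness.

Theorem theorem4p4 (d : Order.disp_t) (Q : unitalQuantaleType d)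
  (hQ : exists p q : Q, p <> q) :
  monadic (goguen_powerset Q).
Proof.
exists (goguen_copowerset Q), (powerset_adjunction Q).
apply: crude_monadicity.
- exact: powerset_reflects_isos.
- exact: powerset_reflexive_coequalizers.
Qed.
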